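(* Let $\mathcal{A}=\mathcal{A}(a,b)$ be an arc in $\mathbb{C}_p$ and $\Phi$ an interlocked family of path sequences. If $f,g \in H(\mathcal{A})$, $f(x)g(x)$ has controlled coefficients of some order $< \frac{1}{2}$ and $f(x)g'(x) \in \mathcal{I}_{\mathcal{A},\Phi}$, then $f'(x)g(x) \in \mathcal{I}_{\mathcal{A},\Phi}$ and $$\int_{\mathcal{A},\Phi}f'(x)g(x)\,dx = -\int_{\mathcal{A},\Phi}f(x)g'(x)\,dx .$$
   Context: $p$ is an odd prime; $\mathbb{C}_p$ is the completion of an algebraic closure of $\mathbb{Q}_p$, with $|p|_p=1/p$. Arc: for $a\ne b$ in $\mathbb{C}_p$ with $R=|a-b|_p$, the arc $\mathcal{A}(a,b)$ is the open disc $\{x : |x-b|_p<R\}$. $H(\mathcal{A})$ is the set of functions on $\mathcal{A}$ given by a single power series convergent on $\mathcal{A}$. $h=\sum_{n\ge0} c_n(x-b)^n\in H(\mathcal{A}(a,b))$ has controlled coefficients of order $\beta\ge0$ if there are real constants $M$ and $n_0>0$ with $|c_n|_pR^n<Mn^\beta$ for all $n>n_0$. Path sequence: a function $\varphi$ defined for all integers $k\ge k_0$ (some $k_0\in\mathbb{Z}^+$), with values in $\mathbb{Z}^+$ and strictly increasing. For $f:\mathcal{A}(a,b)\to\mathbb{C}_p$ put $A_{f,\varphi}(k)=p^{-\varphi(k)}\sum_{\zeta}(x-a)f(x)$, where $x=a+(b-a)\zeta$ and $\zeta$ runs through the $p^{\varphi(k)}$-th roots of unity. A non-empty family $\Phi$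 of path sequences is interlocked if for all $\varphi_1,\varphi_2\in\Phi$ there are $\varphi_3\in\Phi$ and $k_0$ such that $\varphi_3(k)$, $k\ge k_0$, is a subsequence of both $\varphi_1$ and $\varphi_2$. For interlocked $\Phi$, $\int_{\mathcal{A},\Phi}f(x)\,dx=L$ means: for every $\varepsilon>0$ there are $\varphi_\varepsilon\in\Phi$ and $K_\varepsilon$ with $|A_{f,\varphi_\varepsilon}(k)-L|_p<\varepsilon$ for all $k>K_\varepsilon$ (such $L$ is unique if it exists). $\mathcal{I}_{\mathcal{A},\Phi}$ is the set of $f\in H(\mathcal{A})$ for which $\int_{\mathcal{A},\Phi}f(x)\,dx$ exists. *)

(* Defs.v *)
From HB Require Import structures.
From mathcomp Require Import all_boot all_order all_algebra.
From mathcomp Require Import mathcomp_extra boolp classical_sets functions.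
From mathcomp Require Import fsbigop reals topology normedtype sequences exp.

Set Implicit Arguments.
Unset Strict Implicit.
Unset Printing Implicit Defensive.

Import Order.TTheory GRing.Theory Num.Theory.
Import numFieldNormedType.Exports.

Local Open Scope classical_set_scope.
Local Open Scope ring_scope.

Record nonarch_abs (R : realType) (K : fieldType) (v : K -> R) : Prop := {
  nonarch_abs_ge0 : forall x, 0 <= v x;
  nonarch_abs_eq0 : forall x, v x = 0 <-> x = 0;
  nonarch_abs_mul : forall x y, v (x * y) = v x * v y;
  nonarch_abs_add : forall x y, v (x + y) <= Num.max (v x) (v y)
}.

Definition padic_abs (R : realType) (p : nat) (q : rat) : R :=
  if q == 0 then 0
  else p%:R ^+ logn p `|denq q|%N / p%:R ^+ logn p `|numq q|%N.

Definition abs_cvg (R : realType) (K : fieldType) (v : K -> R)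
    (u : nat -> K) (l : K) : Prop :=
  (fun n => v (u n - l)) @ \oo --> (0 : R).

Definition abs_cauchy (R : realType) (K : fieldType) (v : K -> R)
    (u : nat -> K) : Prop :=
  forall e : R, 0 < e ->
    exists N, forall m n, (N <= m)%N -> (N <= n)%N -> v (u m - u n) < e.

Definition abs_complete (R : realType) (K : fieldType) (v : K -> R) : Prop :=
  forall u, abs_cauchy v u -> exists l, abs_cvg v u l.

Definition is_completion (R : realType) (F K : fieldType)
    (vF : F -> R) (vK : K -> R) (i : {rmorphism F -> K}) : Prop :=
  [/\ nonarch_abs vK,
      forall x, vK (i x) = vF x,
      abs_complete vK &
      forall (y : K) (e : R), 0 < e -> exists x : F, vK (y - i x) < e].

Definition is_algebraic_closure (F E : fieldType) (i : {rmorphism F -> E})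
    : Prop :=
  GRing.closed_field_axiom E /\ forall y : E, algebraicOver i y.

(* (K, v) is C_p: the completion of an algebraic closure Qpbar of Q_p, where
   Q_p is the completion of the rationals for |.|_p and Qpbar carries an
   absolute value extending that of Q_p. This determines (K, v) up to
   isometric isomorphism. *)
Definition is_Cp (R : realType) (p : nat) (K : fieldType) (v : K -> R) : Prop :=
  exists (Qp : fieldType) (vQp : Qp -> R) (i : {rmorphism rat -> Qp})
         (Qpbar : fieldType) (vQpbar : Qpbar -> R)
         (j : {rmorphism Qp -> Qpbar}) (k : {rmorphism Qpbar -> K}),
    [/\ is_completion (padic_abs R p) vQp i,
        is_algebraic_closure j,
        nonarch_abs vQpbar,
        forall x, vQpbar (j x) = vQp x &
        is_completion vQpbar v k].

Section Arc.
Variables (R : realType) (K : fieldType) (v : K -> R).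

Definition arc_disc (a b : K) : set K := [set x | v (x - b) < v (a - b)].

(* Functions on an arc are represented by functions on K; every notion below
   depends only on the values taken on the arc. *)
Definition power_series_on (a b : K) (h : K -> K) (c : nat -> K) : Prop :=
  forall x, arc_disc a b x ->
    abs_cvg v (fun n => \sum_(i < n) c i * (x - b) ^+ i) (h x).

Definition arc_H (a b : K) : set (K -> K) :=
  [set h | exists c, power_series_on a b h c].

Definition controlled (a b : K) (beta : R) (h : K -> K) : Prop :=
  exists2 c, power_series_on a b h c &
    exists M n0 : R, 0 < n0 /\
      forall n : nat, n0 < n%:R ->
        v (c n) * v (a - b) ^+ n < M * n%:R `^ beta.

Definition is_abs_deriv (f : K -> K) (x l : K) : Prop :=
  forall e : R, 0 < e -> exists2 d : R, 0 < d &
    forall y, y != x -> v (y - x) < d -> v ((f y - f x) / (y - x) - l) < e.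

(* Equal to 0 where f is not differentiable. *)
Definition abs_deriv (f : K -> K) (x : K) : K :=
  xget 0 [set l | is_abs_deriv f x l].

End Arc.

(* The values of [path_val] below [path_start] are irrelevant. *)
Record path_sequence := PathSequence {
  path_start : nat;
  path_val :> nat -> nat;
  path_start_gt0 : (0 < path_start)%N;
  path_gt0 : forall k, (path_start <= k)%N -> (0 < path_val k)%N;
  path_incr : forall k l, (path_start <= k)%N -> (k < l)%N ->
    (path_val k < path_val l)%N
}.

Definition tail_subsequence (psi : path_sequence) (k0 : nat)
    (phi : path_sequence) : Prop :=
  exists s : nat -> nat,
    (forall k l, (k0 <= k)%N -> (k < l)%N -> (s k < s l)%N) /\
    (forall k, (k0 <= k)%N -> (path_start phi <= s k)%N /\ psi k = phi (s k)).

Definition interlocked (Phi : set path_sequence) : Prop :=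
  Phi !=set0 /\
  forall phi1 phi2, Phi phi1 -> Phi phi2 ->
    exists2 phi3, Phi phi3 &
      exists k0, [/\ (path_start phi3 <= k0)%N,
        tail_subsequence phi3 k0 phi1 & tail_subsequence phi3 k0 phi2].

Section Integral.
Variables (R : realType) (p : nat) (K : fieldType) (v : K -> R).

Definition path_mean (a b : K) (f : K -> K) (phi : path_sequence) (k : nat)
    : K :=
  (p%:R ^+ phi k)^-1 *
  \sum_(z \in [set z : K | z ^+ (p ^ phi k) = 1])
     (let x := a + (b - a) * z in (x - a) * f x).

Definition is_arc_integral (a b : K) (Phi : set path_sequence) (f : K -> K)
    (L : K) : Prop :=
  forall e : R, 0 < e -> exists2 phi, Phi phi &
    exists N : nat, forall k, (path_start phi <= k)%N -> (N < k)%N ->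
      v (path_mean a b f phi k - L) < e.

Definition arc_integral (a b : K) (Phi : set path_sequence) (f : K -> K) : K :=
  xget 0 [set L | is_arc_integral a b Phi f L].

Definition arc_integrable (a b : K) (Phi : set path_sequence) : set (K -> K) :=
  [set f | arc_H v a b f /\ exists L, is_arc_integral a b Phi f L].

End Integral.

(* Main.v *)
(** By the product rule it suffices that the means of [h'], for [h = f g], tend
    to [0] along all path sequences.  Let [h] be the series with coefficients
    [c n] and [N = p ^ k].  The mean of [h'] over the [N]-th roots of unity is
    the sum over [i] of [c (i+1) (b - a)^(i+1)] times [S i / N], where
    [S i = \sum_zeta (i+1) zeta (zeta - 1)^i].  Orthogonality of the roots of
    unity gives [S i = N \sum_(m | N %| m) +-m 'C(i+1, m)], so that
    [|S i / N| <= 1/N], while [|zeta - 1|^N <= 1/p] gives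
    [|S i / N| <= N p^-(i %/ N)].  As the coefficients are [O(n^beta)] with
    [beta < 1/2], the first bound settles the terms with [i < N^2] and the
    second one the others. *)
Require Import Defs.
From HB Require Import structures.
From mathcomp Require Import all_boot all_order all_algebra.
From mathcomp Require Import boolp classical_sets reals.
From mathcomp Require Import functions fsbigop topology normedtype sequences exp.
From mathcomp Require Import ring lra zify.

Set Implicit Arguments.
Unset Strict Implicit.

Import Order.TTheory GRing.Theory Num.Theory.
Import numFieldNormedType.Exports.
Local Open Scope classical_set_scope.
Local Open Scope ring_scope.

(** * Ultrametric inequalities, limits and series *)

Section NonarchimedeanAbsoluteValue.
Variables (R : realType) (K : fieldType) (v : K -> R) (vP : nonarch_abs v).
Implicit Types (x y l : K) (u w : nat -> K) (e B : R).

Lemma abs_ge0 x : 0 <= v x. Proof. exact: nonarch_abs_ge0 vP x. Qed.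

Lemma absM x y : v (x * y) = v x * v y.
Proof. exact: nonarch_abs_mul vP x y. Qed.

Lemma abs0 : v 0 = 0.
Proof. by apply/(nonarch_abs_eq0 vP). Qed.

Lemma abs_eq0 x : (v x == 0) = (x == 0).
Proof. by apply/eqP/eqP => /(nonarch_abs_eq0 vP). Qed.

Lemma abs_gt0 x : (0 < v x) = (x != 0).
Proof. by rewrite lt_def abs_ge0 andbT abs_eq0. Qed.

Lemma abs1 : v 1 = 1.
Proof.
have v1 : v 1 != 0 by rewrite abs_eq0 oner_neq0.
by apply: (mulfI v1); rewrite -absM !mulr1.
Qed.

Lemma absN x : v (- x) = v x.
Proof.
have h : v (- x) ^+ 2 = v x ^+ 2 by rewrite !expr2 -!absM mulrNN.
by apply/eqP; rewrite -(eqrXn2 (n := 2)) ?abs_ge0 ?h.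
Qed.

Lemma absB x y : v (x - y) = v (y - x).
Proof. by rewrite -opprB absN. Qed.

Lemma absX x n : v (x ^+ n) = v x ^+ n.
Proof. by elim: n => [|n IH]; rewrite ?expr0 ?abs1 // !exprS absM IH. Qed.

Lemma absV x : v x^-1 = (v x)^-1.
Proof.
have [->|x0] := eqVneq x 0; first by rewrite invr0 abs0 invr0.
have vx0 : v x != 0 by rewrite abs_eq0.
by apply: (mulfI vx0); rewrite -absM !divff // abs1.
Qed.

Lemma abs_add_le B x y : v x <= B -> v y <= B -> v (x + y) <= B.
Proof.
by move=> hx hy; rewrite (le_trans (nonarch_abs_add vP x y)) // ge_max hx.
Qed.

Lemma abs_add_lt B x y : v x < B -> v y < B -> v (x + y) < B.
Proof.
by move=> hx hy; rewrite (le_lt_trans (nonarch_abs_add vP x y)) // gt_max hx.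
Qed.

Lemma abs_sum_le I (r : seq I) (P : pred I) (F : I -> K) B :
  0 <= B -> (forall i, P i -> v (F i) <= B) -> v (\sum_(i <- r | P i) F i) <= B.
Proof.
move=> B0 FB; elim/big_ind: _ => //; first by rewrite abs0.
by move=> x y; apply: abs_add_le.
Qed.

Lemma abs_mulrn x n : v (x *+ n) <= v x.
Proof.
elim: n => [|n IH]; first by rewrite mulr0n abs0 abs_ge0.
by rewrite mulrS abs_add_le.
Qed.

Lemma abs_cvgP u l :
  abs_cvg v u l <->
  forall e, 0 < e -> exists N, forall n, (N <= n)%N -> v (u n - l) < e.
Proof.
rewrite /abs_cvg cvgr0Pnorm_lt; split=> h e /h.
  move=> [N _ hN]; exists N => n Nn.
  by have := hN n Nn; rewrite /= ger0_norm ?abs_ge0.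
by move=> [N hN]; exists N => // n /= Nn; rewrite ger0_norm ?abs_ge0 ?hN.
Qed.

Lemma abs_lt_eq0 x : (forall e, 0 < e -> v x < e) -> x = 0.
Proof.
move=> h; apply/eqP; rewrite -abs_eq0 eq_le abs_ge0 andbT.
by apply/ler_addgt0Pr => e /h /ltW; rewrite add0r.
Qed.

Lemma abs_cvgD u w l1 l2 : abs_cvg v u l1 -> abs_cvg v w l2 ->
  abs_cvg v (fun n => u n + w n) (l1 + l2).
Proof.
move=> /abs_cvgP h1 /abs_cvgP h2; apply/abs_cvgP => e e0.
have [N1 k1] := h1 _ e0; have [N2 k2] := h2 _ e0.
exists (maxn N1 N2) => n; rewrite geq_max => /andP[n1 n2].
by rewrite opprD addrACA abs_add_lt ?k1 ?k2.
Qed.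

Lemma abs_cvgMl x u l : abs_cvg v u l -> abs_cvg v (fun n => x * u n) (x * l).
Proof.
move=> /abs_cvgP h; apply/abs_cvgP => e e0.
have [->|x0] := eqVneq x 0.
  by exists 0%N => n _; rewrite !mul0r subr0 abs0.
have vx0 : 0 < v x by rewrite abs_gt0.
have [N k] := h _ (divr_gt0 e0 vx0).
by exists N => n /k; rewrite -mulrBr absM ltr_pdivlMr // mulrC.
Qed.

Lemma abs_cvg_ext u w l : abs_cvg v u l -> u =1 w -> abs_cvg v w l.
Proof. by move=> h /funext <-. Qed.

Lemma abs_cvg_cst l : abs_cvg v (fun=> l) l.
Proof.
by apply/abs_cvgP => e e0; exists 0%N => n _; rewrite subrr abs0.
Qed.

Lemma abs_cvg_sum I (r : seq I) (u : I -> nat -> K) (l : I -> K) :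
  (forall i, abs_cvg v (u i) (l i)) ->
  abs_cvg v (fun n => \sum_(i <- r) u i n) (\sum_(i <- r) l i).
Proof.
move=> h; elim: r => [|i r IH].
  rewrite [X in abs_cvg _ _ X]big_nil.
  by apply: (abs_cvg_ext (abs_cvg_cst _)) => n; rewrite big_nil.
rewrite [X in abs_cvg _ _ X]big_cons.
apply: (abs_cvg_ext (abs_cvgD (h i) IH)) => n.
by rewrite big_cons.
Qed.

Lemma abs_cvg_le u l B : abs_cvg v u l -> (forall n, v (u n) <= B) -> v l <= B.
Proof.
move=> /abs_cvgP h uB; have B0 : 0 <= B := le_trans (abs_ge0 _) (uB 0%N).
apply/ler_addgt0Pr => e e0; have [N k] := h _ e0.
have -> : l = u N - (u N - l) by rewrite subKr.
have := k N (leqnn N) => /ltW kN.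
apply: abs_add_le; first by rewrite (le_trans (uB N)) // lerDl ltW.
by rewrite absN (le_trans kN) // lerDr.
Qed.

Lemma abs_cvg_bounded u l : abs_cvg v u l ->
  exists2 B, 0 < B & forall n, v (u n) <= B.
Proof.
move=> /abs_cvgP /(_ _ ltr01)[N hN].
have S0 m : 0 <= \sum_(i < m) v (u i) by apply: sumr_ge0 => i _; exact: abs_ge0.
exists (1 + v l + \sum_(i < N) v (u i)).
  by rewrite ltr_pwDl // ltr_pwDl // abs_ge0.
move=> n; have [Nn|nN] := leqP N n.
  rewrite -[u n](subrK l); have := abs_ge0 l; have := S0 N; have := hN n Nn.
  move=> h0 h1 h2; apply: abs_add_le; lra.
rewrite (bigD1 (Ordinal nN)) //= addrCA lerDl addr_ge0 //.
  by rewrite addr_ge0 ?abs_ge0.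
by apply: sumr_ge0 => i _; exact: abs_ge0.
Qed.

(** By the ultrametric inequality a difference of partial sums is bounded by its largest term, so
    null terms make the partial sums Cauchy. *)
Lemma abs_series_cvg u : abs_complete v -> abs_cvg v u 0 ->
  exists l, abs_cvg v (fun n => \sum_(i < n) u i) l.
Proof.
move=> cv /abs_cvgP u0; apply: cv => e e0.
have [N hN] := u0 _ (divr_gt0 e0 (ltr0Sn R 1)).
have main m n : (N <= m)%N -> (m <= n)%N ->
    v (\sum_(i < n) u i - \sum_(i < m) u i) < e.
  move=> Nm mn; rewrite -!(big_mkord xpredT) (big_cat_nat (n := m)) //=.
  rewrite [X in X - _]addrC addrK; apply: (@le_lt_trans _ _ (e / 2)); last by lra.
  rewrite big_seq; apply: abs_sum_le => [|i]; first by lra.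
  rewrite mem_index_iota => /andP[mi _]; rewrite -[u i]subr0 ltW // hN //.
  exact: leq_trans mi.
exists N => m n Nm Nn; case: (leqP m n) => mn; first by rewrite absB main.
by rewrite main // ltnW.
Qed.

Lemma abs_series_term u l :
  abs_cvg v (fun n => \sum_(i < n) u i) l -> abs_cvg v u 0.
Proof.
move=> /abs_cvgP h; apply/abs_cvgP => e /h[N hN]; exists N => n Nn.
have -> : u n - 0 = (\sum_(i < n.+1) u i - l) - (\sum_(i < n) u i - l).
  by rewrite big_ord_recr /=; ring.
by rewrite abs_add_lt ?absN ?hN // ltnW.
Qed.

(** For [N1 + N2 <= n], each product has [N1 <= i] or [N2 <= n - i]: one factor is small and the
    other is bounded. The ultrametric inequality makes the number of terms irrelevant. *)
Lemma abs_convolution_cvg0 u w : abs_cvg v u 0 -> abs_cvg v w 0 ->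
  abs_cvg v (fun n => \sum_(i < n) u i * w (n - i)%N) 0.
Proof.
move=> hu hw; have [B1 B10 uB] := abs_cvg_bounded hu.
have [B2 B20 wB] := abs_cvg_bounded hw.
move: hu hw => /abs_cvgP hu /abs_cvgP hw; apply/abs_cvgP => e e0.
have e2 : 0 < e / 2 by lra.
have [N1 k1] := hu _ (divr_gt0 e2 B20).
have [N2 k2] := hw _ (divr_gt0 e2 B10).
exists (N1 + N2)%N => n Nn; rewrite subr0.
apply: (@le_lt_trans _ _ (e / 2)); last by lra.
apply: abs_sum_le => [|i _]; first exact: ltW.
rewrite absM; have [iN|iN] := leqP N1 i.
  have := k1 _ iN; rewrite subr0 => /ltW k.
  by rewrite -[e / 2](@divfK _ B2) ?gt_eqF // ler_pM ?abs_ge0.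
have /k2 : (N2 <= n - i)%N.
  by rewrite leq_subRL ?(ltnW (ltn_ord i)) // (leq_trans _ Nn) // leq_add2r ltnW.
rewrite subr0 => /ltW k.
by rewrite -[e / 2](@divfK _ B1) ?gt_eqF // mulrC ler_pM ?abs_ge0.
Qed.

(** Summed over the triangle, the left side is the convolution of [u] with the partial sums of [w].
    Splitting these into [lw] and a null remainder leaves [lw] times a partial sum of [u], plus a
    null convolution. *)
Lemma abs_cauchy_product u w lu lw :
  abs_cvg v (fun n => \sum_(i < n) u i) lu ->
  abs_cvg v (fun n => \sum_(i < n) w i) lw ->
  abs_cvg v (fun n => \sum_(m < n) \sum_(i < m.+1) u i * w (m - i)%N) (lu * lw).
Proof.
move=> hu hw.
have hr : abs_cvg v (fun n => \sum_(i < n) w i - lw) 0.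
  by rewrite -[X in abs_cvg _ _ X](subrr lw); exact: (abs_cvgD hw (abs_cvg_cst _)).
have h0 := abs_convolution_cvg0 (abs_series_term hu) hr.
rewrite mulrC -[lw * lu]add0r; apply: (abs_cvg_ext (abs_cvgD h0 (abs_cvgMl lw hu))).
move=> n; have -> : \sum_(m < n) \sum_(i < m.+1) u i * w (m - i)%N =
    \sum_(i < n) u i * \sum_(j < n - i) w j.
  elim: n => [|n IH]; first by rewrite !big_ord0.
  rewrite big_ord_recr /= IH.
  rewrite [in RHS](eq_bigr (fun i : 'I_n.+1 =>
    u i * (\sum_(j < n - i) w j) + u i * w (n - i)%N)); last first.
    by move=> i _; rewrite subSn -1?ltnS // big_ord_recr /= mulrDr.
  rewrite big_split /=; congr (_ + _).
  by rewrite big_ord_recr /= subnn big_ord0 mulr0 addr0.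
by rewrite mulr_sumr -big_split /=; apply: eq_bigr => i _; ring.
Qed.

End NonarchimedeanAbsoluteValue.

(** * Derivatives and products of power series on an arc *)

Section PowerSeries.
Variables (R : realType) (K : fieldType) (v : K -> R) (vP : nonarch_abs v).
(* The powers of [pi] show that no point is isolated, so that derivatives are
   unique. *)
Variables (cv : abs_complete v) (pi : K) (pi0 : pi != 0) (pi1 : v pi < 1).
Implicit Types (x y l : K) (f g h : K -> K) (c : nat -> K) (e B : R).

Lemma is_abs_deriv_unique f x l1 l2 :
  is_abs_deriv v f x l1 -> is_abs_deriv v f x l2 -> l1 = l2.
Proof.
move=> h1 h2; apply/eqP; rewrite -subr_eq0; apply/eqP/(abs_lt_eq0 vP) => e e0.
have [d1 d10 k1] := h1 _ e0; have [d2 d20 k2] := h2 _ e0.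
have d0 : 0 < Num.min d1 d2 by rewrite lt_min d10.
have : abs_cvg v (fun n => pi ^+ n) 0.
  have /cvgrPdist_lt c0 : (v pi ^+ n) @[n --> \oo] --> (0 : R).
    by apply: cvg_expr; rewrite ger0_norm ?(abs_ge0 vP).
  apply/(abs_cvgP vP) => eps /c0[N _ hN]; exists N => n Nn.
  have := hN n Nn; rewrite /= sub0r normrN subr0 (absX vP) ger0_norm //.
  by rewrite exprn_ge0 ?(abs_ge0 vP).
move=> /(abs_cvgP vP)/(_ _ d0)[N /(_ N (leqnn N))].
rewrite subr0 lt_min => /andP[q1 q2].
have yx : x + pi ^+ N != x by rewrite addrC -subr_eq0 addrK expf_neq0.
have := k2 _ yx; have := k1 _ yx; rewrite [_ - x]addrC addKr => /(_ q1) + /(_ q2).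
set q := (f _ - f x) / _ => {}k1 {}k2.
have -> : l1 - l2 = (q - l2) - (q - l1) by ring.
by apply: (abs_add_lt vP); rewrite ?(absN vP).
Qed.

Lemma abs_derivE f x l : is_abs_deriv v f x l -> abs_deriv v f x = l.
Proof.
by move=> h; apply: xget_unique => // l' /is_abs_deriv_unique/(_ h).
Qed.

Lemma is_abs_derivM f g x lf lg :
  is_abs_deriv v f x lf -> is_abs_deriv v g x lg ->
  is_abs_deriv v (fun y => f y * g y) x (lf * g x + f x * lg).
Proof.
move=> hf hg e e0.
pose B := 1 + v lf + v lg + v (f x) + v (g x).
have := (abs_ge0 vP lf, abs_ge0 vP lg, abs_ge0 vP (f x), abs_ge0 vP (g x)).
case=> [[[A1 A2] A3] A4].
have B1 : 1 <= B by rewrite /B; lra.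
have B0 : 0 < B by lra.
have e'0 : 0 < Num.min 1 (e / B) by rewrite lt_min ltr01 divr_gt0.
have [d1 d10 k1] := hf _ e'0; have [d2 d20 k2] := hg _ e'0.
(* [B] bounds both difference quotients, so the radius [e / B ^+ 2] makes the cross term
   [qf * (qg * (y - x))] smaller than [e]. *)
exists (Num.min (Num.min d1 d2) (e / B ^+ 2)).
  by rewrite !lt_min d10 d20 divr_gt0 // exprn_gt0.
move=> y yx; rewrite !lt_min => /andP[/andP[y1 y2] y3].
move: (k1 _ yx y1) (k2 _ yx y2).
set qf := (f y - f x) / _; set qg := (g y - g x) / _.
rewrite !lt_min => /andP[qf1 qfe] /andP[qg1 qge].
have yx0 : y - x != 0 by rewrite subr_eq0.
have fy : f y = f x + qf * (y - x) by rewrite /qf divfK // addrC subrK.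
have gy : g y = g x + qg * (y - x) by rewrite /qg divfK // addrC subrK.
have -> : (f y * g y - f x * g x) / (y - x) - (lf * g x + f x * lg) =
    ((qf - lf) * g x + f x * (qg - lg)) + qf * (qg * (y - x)).
  by rewrite fy gy; field.
have eB x1 x2 : v x1 < e / B -> v x2 <= B -> v (x1 * x2) < e.
  move=> h1 h2; rewrite (absM vP) (@le_lt_trans _ _ (v x1 * B)) //.
    by rewrite ler_wpM2l ?(abs_ge0 vP).
  by rewrite -ltr_pdivlMr.
have qB q l : v (q - l) < 1 -> 1 + v l <= B -> v q <= B.
  move=> h1 h2; rewrite -[q](subrK l).
  have := abs_ge0 vP l; move=> h3; apply: (abs_add_le vP); lra.
apply: (abs_add_lt vP); first apply: (abs_add_lt vP).
- by apply: eB => //; rewrite /B; lra.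
- by rewrite mulrC; apply: eB => //; rewrite /B; lra.
rewrite mulrC; apply: eB; last by apply: qB qf1 _; rewrite /B; lra.
rewrite (absM vP).
have hq : v qg <= B by apply: qB qg1 _; rewrite /B; lra.
apply: (@le_lt_trans _ _ (B * v (y - x))).
  by rewrite ler_wpM2r ?(abs_ge0 vP).
by rewrite mulrC ltr_pdivlMr // -mulrA -expr2 -ltr_pdivlMr // exprn_gt0.
Qed.

(* The second-order Taylor remainder of [z ^ n] at [t]; multiplying by
   [r ^ 2] keeps the exponent [n - 2] out of the statement. *)
Lemma abs_taylor_monomial (s t r : K) n : v s <= v r -> v t <= v r ->
  v (s ^+ n - t ^+ n - t ^+ n.-1 * (s - t) *+ n) * v r ^+ 2
    <= v r ^+ n * v (s - t) ^+ 2.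
Proof.
move=> sr tr; elim: n => [|n IH].
  rewrite !expr0 subrr mulr0n subr0 (abs0 vP) mul0r mul1r.
  by rewrite exprn_ge0 ?(abs_ge0 vP).
set E := s ^+ n - _ - _ in IH.
(* The remainders satisfy a recurrence of order one, whose two terms are bounded separately. *)
have -> : s ^+ n.+1 - t ^+ n.+1 - t ^+ n.+1.-1 * (s - t) *+ n.+1 =
    s * E + t ^+ n.-1 * (s - t) ^+ 2 *+ n.
  rewrite /E; case: n {IH E} => [|n] /=; first by rewrite !mulr0n; ring.
  rewrite [s ^+ n.+2]exprS [t ^+ n.+2]exprS [s ^+ n.+1]exprS [t ^+ n.+1]exprS.
  by move: (s ^+ n) (t ^+ n) => S T; ring.
rewrite -[v r ^+ 2](absX vP) -(absM vP) mulrDl; apply: (abs_add_le vP).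
  rewrite -mulrA (absM vP) (absM vP E) (absX vP) (exprS (v r) n) -[leRHS]mulrA.
  by rewrite ler_pM ?mulr_ge0 ?exprn_ge0 ?(abs_ge0 vP).
case: n {IH E} => [|n] /=.
  by rewrite mulr0n mul0r (abs0 vP) mulr_ge0 ?exprn_ge0 ?(abs_ge0 vP).
rewrite mulrnAl; apply: le_trans (abs_mulrn vP _ _) _.
rewrite mulrAC 2!(absM vP _ (_ ^+ 2)) !(absX vP).
rewrite ler_wpM2r ?exprn_ge0 ?(abs_ge0 vP) // -[n.+2]addn2 exprD.
by rewrite ler_wpM2r ?exprn_ge0 ?(abs_ge0 vP) // lerXn2r ?nnegrE ?(abs_ge0 vP).
Qed.

(** The radius is the absolute value of an element [r] of [K], so that a series can be evaluated at
    [b + r]. At the centre, where [x - b] vanishes, [pi * (a - b)] takes its place. *)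
Lemma arc_disc_radius a b x : arc_disc v a b x ->
  exists r, [/\ r != 0, v (x - b) <= v r & v r < v (a - b)].
Proof.
rewrite /arc_disc /= => xab.
have [t0|t0] := eqVneq (x - b) 0; last by exists (x - b).
have ab0 : a - b != 0 by rewrite -(abs_gt0 vP) (le_lt_trans (abs_ge0 vP _) xab).
exists (pi * (a - b)); rewrite mulf_neq0 // t0 (abs0 vP) (abs_ge0 vP).
by rewrite (absM vP) gtr_pMl // (abs_gt0 vP).
Qed.

Lemma abs_cvg_shift (u : nat -> K) l :
  abs_cvg v u l -> abs_cvg v (fun n => u n.+1) l.
Proof.
move=> /(abs_cvgP vP) h; apply/(abs_cvgP vP) => e /h[N hN].
by exists N => n Nn; apply: hN; rewrite ltnW.
Qed.

Definition deriv_coef c n := c n.+1 *+ n.+1.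

(** Convergence at [b + r] makes the terms [c i * r ^+ i] null, hence bounded by some [B]. Summing
    the Taylor remainders of the monomials then bounds the remainder of [h] by
    [B |y - x|^2 / |r|^2], which is small compared with [|y - x|]. *)
Lemma power_series_is_abs_deriv a b h c x :
  power_series_on v a b h c -> arc_disc v a b x ->
  exists2 l, is_abs_deriv v h x l &
    abs_cvg v (fun n => \sum_(i < n) deriv_coef c i * (x - b) ^+ i) l.
Proof.
move=> hc xab; have [r [r0 tr rab]] := arc_disc_radius xab.
have vr0 : 0 < v r by rewrite (abs_gt0 vP).
have rD : arc_disc v a b (b + r) by rewrite /arc_disc /= addrC addKr.
have := hc _ rD; rewrite [b + r - b]addrC addKr.
move=> /(abs_series_term (u := fun i => c i * r ^+ i) vP) cr0.
have [B B0 cB] := abs_cvg_bounded vP cr0.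
have [l hl] : exists l,
    abs_cvg v (fun n => \sum_(i < n) deriv_coef c i * (x - b) ^+ i) l.
  apply: (abs_series_cvg (u := fun i => deriv_coef c i * _) vP cv).
  apply/(abs_cvgP vP) => e e0.
  have [N hN] := (abs_cvgP vP _ _).1 cr0 _ (mulr_gt0 e0 vr0).
  exists N => n Nn; have := hN n.+1 (leqW Nn); rewrite !subr0.
  rewrite !(absM vP) !(absX vP) exprSr mulrA ltr_pM2r //; apply: le_lt_trans.
  rewrite ler_pM ?exprn_ge0 ?(abs_ge0 vP) ?(abs_mulrn vP) //.
  by rewrite lerXn2r ?nnegrE ?(abs_ge0 vP).
exists l => // e e0.
(* The first bound keeps [y] within [|r|] of [b]; the second makes the remainder divided by [y - x]
   smaller than [e]. *)
exists (Num.min (v r) (e * v r ^+ 2 / B)).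
  by rewrite lt_min vr0 divr_gt0 // mulr_gt0 // exprn_gt0.
move=> y yx; rewrite lt_min => /andP[yr ye].
have yx0 : y - x != 0 by rewrite subr_eq0.
have sr : v (y - b) <= v r.
  have -> : y - b = (y - x) + (x - b) by ring.
  by apply: (abs_add_le vP) => //; exact: ltW.
have yab : arc_disc v a b y by exact: le_lt_trans rab.
(* The partial sums of [h] run one index further than those of the derived series: the constant term
   has remainder 0 and contributes no derivative. *)
have lim : abs_cvg v (fun n => \sum_(i < n.+1) c i *
    ((y - b) ^+ i - (x - b) ^+ i - (x - b) ^+ i.-1 * (y - x) *+ i))
    (h y - h x - l * (y - x)).
  have h1 := abs_cvg_shift (hc _ yab).
  have h2 := abs_cvgMl vP (-1) (abs_cvg_shift (hc _ xab)).
  have h3 := abs_cvgMl vP (- (y - x)) hl.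
  have -> : h y - h x - l * (y - x) = h y + -1 * h x + - (y - x) * l by ring.
  apply: (abs_cvg_ext (abs_cvgD vP (abs_cvgD vP h1 h2) h3)) => n.
  rewrite !mulr_sumr -big_split /= !big_ord_recl /= -[LHS]addrA -big_split /=.
  rewrite mulr0n subr0 [in RHS]mulrBr mulN1r; congr (_ + _); apply: eq_bigr => i _.
  rewrite /deriv_coef /bump /= add1n /=.
  by move: (_ ^+ i.+1) (_ ^+ i.+1) (_ ^+ i) => S T U; ring.
have : v (h y - h x - l * (y - x)) <= B * v (y - x) ^+ 2 / v r ^+ 2.
  apply: (abs_cvg_le vP lim) => n.
  have C0 : 0 <= B * v (y - x) ^+ 2 / v r ^+ 2.
    by rewrite divr_ge0 ?mulr_ge0 ?exprn_ge0 ?(abs_ge0 vP) ?ltW.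
  apply: (abs_sum_le vP) => // i _; rewrite ler_pdivlMr ?exprn_gt0 //.
  have := abs_taylor_monomial i sr tr; have -> : y - b - (x - b) = y - x by ring.
  move=> /(ler_wpM2l (abs_ge0 vP (c i))); rewrite mulrA -(absM vP) => /le_trans.
  apply; rewrite mulrA -(absX vP r) -(absM vP).
  by rewrite ler_wpM2r ?exprn_ge0 ?(abs_ge0 vP).
move=> bound.
have -> : (h y - h x) / (y - x) - l = (h y - h x - l * (y - x)) / (y - x).
  by field.
have vyx : 0 < v (y - x) by rewrite (abs_gt0 vP).
rewrite (absM vP) (absV vP) ltr_pdivrMr //; apply: le_lt_trans bound _.
rewrite ltr_pdivrMr ?exprn_gt0 // expr2 mulrA [ltRHS]mulrAC ltr_pM2r //.
by rewrite mulrC -ltr_pdivlMr.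
Qed.

Lemma power_series_deriv a b h c : power_series_on v a b h c ->
  power_series_on v a b (abs_deriv v h) (deriv_coef c).
Proof.
move=> hc x xab; have [l hl] := power_series_is_abs_deriv hc xab.
by rewrite (abs_derivE hl).
Qed.

Lemma arc_H_is_abs_deriv a b h x : arc_H v a b h -> arc_disc v a b x ->
  is_abs_deriv v h x (abs_deriv v h x).
Proof.
move=> [c hc] xab; have [l hl _] := power_series_is_abs_deriv hc xab.
by rewrite (abs_derivE hl).
Qed.

Lemma arc_H_deriv a b h : arc_H v a b h -> arc_H v a b (abs_deriv v h).
Proof. by move=> [c /power_series_deriv hc]; exists (deriv_coef c). Qed.

Lemma arc_H_mul a b f g : arc_H v a b f -> arc_H v a b g ->
  arc_H v a b (fun x => f x * g x).
Proof.
move=> [c hc] [d hd]; exists (fun n => \sum_(i < n.+1) c i * d (n - i)%N).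
move=> x xab.
have h := abs_cauchy_product (u := fun i => c i * (x - b) ^+ i)
  (w := fun i => d i * (x - b) ^+ i) vP (hc x xab) (hd x xab).
apply: (abs_cvg_ext h) => n.
apply: eq_bigr => m _; rewrite mulr_suml; apply: eq_bigr => i _.
by rewrite mulrACA -exprD subnKC // -ltnS.
Qed.

End PowerSeries.

(** * Roots of unity of order a power of [p], and their moments *)

Lemma sum_expr_prim_root (F : fieldType) N (w : F) j : N.-primitive_root w ->
  \sum_(i < N) (w ^+ i) ^+ j = if (N %| j)%N then N%:R else 0.
Proof.
move=> prw; under eq_bigr do rewrite -exprM mulnC exprM.
rewrite (prim_order_dvd prw); case: eqP => [->|/eqP wj].
  under eq_bigr do rewrite expr1n.
  by rewrite sumr_const card_ord.
have wj1 : w ^+ j - 1 != 0 by rewrite subr_eq0.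
apply: (mulfI wj1); rewrite mulr0 -subrX1 -exprM mulnC exprM.
by rewrite (prim_expr_order prw) expr1n subrr.
Qed.

(** [i * 'C(p ^ k, i)] is a multiple of [p ^ k]. Were the binomial prime to [p], then [p ^ k] would
    divide [i], which is positive and smaller. *)
Lemma dvdn_bin_prime_power p k i : prime p ->
  (0 < i < p ^ k)%N -> (p %| 'C(p ^ k, i))%N.
Proof.
move=> pp /andP[i0 ik]; apply/idPn => npC.
have : (p ^ k %| i)%N.
  have co : coprime (p ^ k) 'C(p ^ k, i) by rewrite coprimeXl // prime_coprime.
  rewrite -(Gauss_dvdl _ co); case: i i0 {ik npC co} => // i _.
  by rewrite -mul_bin_diag dvdn_mulr.
by move=> /(dvdn_leq i0); rewrite leqNgt ik.
Qed.

Section PadicEstimates.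
Variables (R : realType) (K : fieldType) (v : K -> R) (vP : nonarch_abs v).
Variables (p : nat) (pp : prime p) (vp : v p%:R = p%:R^-1).

Lemma abs_natX k : v (p ^ k)%:R = (p ^ k)%:R^-1.
Proof. by rewrite !natrX (absX vP) vp exprVn. Qed.

Lemma abs_natr_dvd k m : (p ^ k %| m)%N -> v m%:R <= (p ^ k)%:R^-1.
Proof.
by move=> /dvdnP[q ->]; rewrite mulnC natrM mulr_natr -abs_natX (abs_mulrn vP).
Qed.

Lemma abs_unity_root N z : (0 < N)%N -> z ^+ N = 1 -> v z = 1.
Proof.
move=> N0 zN; apply/eqP; rewrite -(@pexpr_eq1 _ _ N) ?(abs_ge0 vP) //.
by rewrite -(absX vP) zN (abs1 vP).
Qed.

(* [z ^ N - 1] and [(z - 1) ^ N] agree modulo [p]. *)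
Lemma abs_unity_root_sub1 k z : z ^+ (p ^ k) = 1 ->
  v (z - 1) ^+ (p ^ k) <= p%:R^-1.
Proof.
move=> zN; have N0 : (0 < p ^ k)%N by rewrite expn_gt0 prime_gt0.
have vz : v (z - 1) <= 1.
  by apply: (abs_add_le vP); rewrite ?(absN vP) ?(abs1 vP) ?(abs_unity_root N0 zN).
move: zN; rewrite -{1}[z](subrK 1) exprDn.
have dv i : (0 < i < p ^ k)%N -> v ('C(p ^ k, i))%:R <= p%:R^-1.
  by move=> /(dvdn_bin_prime_power pp); rewrite -{1}(expn1 p) => /abs_natr_dvd.
case: (p ^ k)%N N0 dv => // n _ dv.
(* The end terms of the expansion of [((z - 1) + 1) ^+ (p ^ k) = 1] are split off. The two 1's
   cancel, so [(z - 1) ^+ (p ^ k)] is minus the sum of the middle terms. *)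
rewrite big_ord_recl big_ord_recr /= subn0 subnn !expr0 mulr1 mul1r expr1n bin0.
rewrite /bump /= add1n binn !mulr1n addrA => /(canRL (addrK _)).
rewrite subrr => /eqP; rewrite addr_eq0 -(absX vP) => /eqP ->; rewrite (absN vP).
apply: (abs_sum_le vP) => [|i _]; first by rewrite invr_ge0.
rewrite expr1n mulr1 -mulr_natr (absM vP) (absX vP) -[leRHS]mul1r.
rewrite ler_pM ?exprn_ge0 ?(abs_ge0 vP) ?exprn_ile1 ?(abs_ge0 vP) //.
by apply: dv; rewrite /= add1n ltnS ltn_ord.
Qed.

Lemma abs_unity_root_sub1_lt1 k z : z ^+ (p ^ k) = 1 -> v (z - 1) < 1.
Proof.
move=> /abs_unity_root_sub1 h; rewrite ltNge; apply/negP => /exprn_ege1.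
move=> /(_ (p ^ k)%N)/le_trans/(_ h); rewrite leNgt => /negP; apply.
by rewrite invf_lt1 ?ltr0n ?ltr1n ?prime_gt0 ?prime_gt1.
Qed.

Section UnityRootMoments.
Variables (k : nat) (w : K) (prw : (p ^ k).-primitive_root w).
Let N := (p ^ k)%N.

Definition unity_root_moment i := \sum_(j < N) w ^+ j * (w ^+ j - 1) ^+ i *+ i.+1.

(** After binomial expansion, orthogonality keeps only the exponents [m = (i - l).+1] divisible by
    [N]. The identity [(i + 1) 'C(i, l) = m 'C(i + 1, m)] then exhibits the factor [m]. *)
Lemma unity_root_moment_expand i : unity_root_moment i =
  \sum_(l < i.+1 | (N %| (i - l).+1)%N)
     (-1) ^+ l * N%:R * ((i - l).+1 * 'C(i.+1, (i - l).+1))%:R.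
Proof.
rewrite /unity_root_moment.
under eq_bigr => j _ do rewrite exprBn mulr_sumr -sumrMnl.
rewrite exchange_big [RHS]big_mkcond /=; apply: eq_bigr => l _.
have il : (l <= i)%N by rewrite -ltnS.
rewrite (eq_bigr (fun j : 'I_N => (-1) ^+ l * ((i.+1 * 'C(i, l))%:R) *
   (w ^+ j) ^+ (i - l).+1)); last first.
  move=> j _; rewrite expr1n natrM exprS.
  by move: (w ^+ j) ((w ^+ j) ^+ _) ((-1) ^+ l) => x y z; ring.
rewrite -mulr_sumr (sum_expr_prim_root _ prw); case: ifP => _; last exact: mulr0.
by rewrite -(bin_sub il) (mul_bin_diag i.+1) mulrAC.
Qed.

(** One factor [1 / N] comes from the [N] of orthogonality, the other from the multiple [(i - l).+1]
    of [N]. *)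
Lemma abs_unity_root_moment_le i :
  v (unity_root_moment i) <= N%:R^-1 * N%:R^-1.
Proof.
rewrite unity_root_moment_expand.
apply: (abs_sum_le vP) => [|l Nl]; first by rewrite mulr_ge0 ?invr_ge0.
rewrite !(absM vP) (absX vP) (absN vP) (abs1 vP) expr1n mul1r.
by rewrite ler_pM ?(abs_ge0 vP) ?abs_natX // abs_natr_dvd // dvdn_mulr.
Qed.

(** [|zeta - 1| ^ i] contains [i %/ N] full powers [|zeta - 1| ^ N], each at most [1 / p]; the
    leftover factor is at most 1. *)
Lemma abs_unity_root_moment_exp i :
  v (unity_root_moment i) <= p%:R ^- (i %/ N).
Proof.
have N0 : (0 < N)%N by rewrite expn_gt0 prime_gt0.
apply: (abs_sum_le vP) => [|j _]; first by rewrite invr_ge0 exprn_ge0.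
apply: le_trans (abs_mulrn vP _ _) _.
have wjN : (w ^+ j) ^+ N = 1.
  by rewrite -exprM mulnC exprM (prim_expr_order prw) expr1n.
rewrite (absM vP) (abs_unity_root N0 wjN) mul1r (absX vP).
have h := abs_unity_root_sub1 wjN; have h1 := abs_unity_root_sub1_lt1 wjN.
have v0 := abs_ge0 vP (w ^+ j - 1).
rewrite {1}(divn_eq i N) exprD mulnC exprM -exprVn.
apply: (@le_trans _ _ ((v (w ^+ j - 1) ^+ N) ^+ (i %/ N))).
  by rewrite ler_piMr ?exprn_ge0 ?exprn_ile1 // ltW.
by rewrite lerXn2r ?nnegrE ?exprn_ge0 ?invr_ge0.
Qed.

End UnityRootMoments.
End PadicEstimates.

(** * Polynomial growth against exponential decay *)

(** With [q = 4 m + r] and [r < 4], the fourth power of [q + 1 <= 4 (m + 1) <= 4 * 2 ^ m] gives the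
    bound. *)
Lemma quartic_le_exp2 q : (q.+1 ^ 4 <= 256 * 2 ^ q)%N.
Proof.
have [m [r [-> r4]]] : exists m r, q = (m * 4 + r)%N /\ (r < 4)%N.
  by exists (q %/ 4)%N, (q %% 4)%N; rewrite -divn_eq ltn_pmod.
have h : ((m * 4 + r).+1 <= 4 * 2 ^ m)%N.
  by have := ltn_expl m (ltnSn 1); lia.
apply: (@leq_trans ((4 * 2 ^ m) ^ 4)); first by rewrite leq_exp2r.
by rewrite expnMn -expnM leq_mul // leq_exp2l // leq_addr.
Qed.

(* The two bounds on [t] are used for [i < p ^ 2k] and [p ^ 2k <= i]
   respectively; the first is where [beta < 1 / 2] is needed. *)
Lemma powR_mul_small (R : realType) p (beta M e : R) : (1 < p)%N ->
  0 <= beta -> beta < 1 / 2 -> 0 < M -> 0 < e ->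
  exists k0, forall k i t, (k0 <= k)%N -> 0 <= t ->
    t <= (p ^ k)%:R^-1 -> t <= (p ^ k)%:R * p%:R ^- (i %/ p ^ k) ->
    M * i.+1%:R `^ beta * t < e.
Proof.
move=> p1 b0 b12 M0 e0; pose g := 1 - 2 * beta.
have g0 : 0 < g by rewrite /g; lra.
(* The first threshold yields [M / e < N ^ g], which settles [i < N ^ 2] since the product is then
   at most [M N ^ (2 beta - 1) = M N ^ (- g)]. The second yields [256 M / e < q] for the remaining
   [i]. *)
pose X := Num.max ((M / e) `^ g^-1) (256 * M / e).
exists (Num.Def.trunc X).+1 => k i t k0 t0 t1 t2.
set N := (p ^ k)%N in t1 t2 *.
have N0 : (0 < N)%N by rewrite expn_gt0 (ltnW p1).
have NR0 : 0 < N%:R :> R by rewrite ltr0n.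
have : X < N%:R.
  apply: (lt_trans (truncnS_gt X)); rewrite ltr_nat (leq_ltn_trans k0) //.
  exact: ltn_expl.
rewrite gt_max => /andP[X1 X2].
have [iN|Ni] := ltnP i (N ^ 2).
  have hb : i.+1%:R `^ beta <= N%:R `^ (2 * beta).
    rewrite powRrM (powR_mulrn 2) // -natrX.
    by apply: ge0_ler_powR; rewrite ?nnegrE // ler_nat.
  apply: (@le_lt_trans _ _ (M * N%:R `^ (2 * beta) * N%:R^-1)).
    by rewrite ler_pM ?mulr_ge0 ?powR_ge0 ?(ltW M0) // ler_wpM2l // ltW.
  have gN : M / e < N%:R `^ g.
    have h : ((M / e) `^ g^-1) `^ g = M / e.
      by rewrite -powRrM mulVf ?gt_eqF // powRr1 // divr_ge0 // ltW.
    by rewrite -h gt0_ltr_powR // nnegrE ?powR_ge0.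
  have -> : 2 * beta = 1 - g by rewrite /g; ring.
  rewrite powRB; last by rewrite pnatr_eq0 -lt0n N0 implybT.
  rewrite powRr1 //.
  rewrite mulrA mulrAC mulfK ?gt_eqF // ltr_pdivrMr ?powR_gt0 //.
  by rewrite mulrC -ltr_pdivrMr.
have qN : (N <= i %/ N)%N by rewrite leq_divRL // mulnn.
set q := (i %/ N)%N in t2 qN.
have q0 : 0 < q%:R :> R by rewrite ltr0n (leq_trans N0).
(* The exponent is weakened to 1, a loss that the exponential decay absorbs. Since [N <= q],
   everything is then bounded in terms of [q] alone. *)
have iq : i.+1%:R `^ beta <= q.+1%:R * N%:R.
  have i1 : i.+1%:R `^ beta <= i.+1%:R by rewrite ler1_powR ?ler1n //; lra.
  by apply: le_trans i1 _; rewrite -natrM ler_nat ltn_ceil.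
have pq : p%:R ^- q <= 2%:R ^- q :> R.
  by rewrite lef_pV2 ?posrE ?exprn_gt0 ?ltr0n ?(ltnW p1) // lerXn2r ?nnegrE ?ler_nat.
have h2 : 0 < 2%:R ^+ q :> R by rewrite exprn_gt0.
apply: (@le_lt_trans _ _ (M * (q.+1%:R * q%:R) * (q%:R * 2%:R ^- q))).
  rewrite ler_pM ?mulr_ge0 ?powR_ge0 ?(ltW M0) //.
    rewrite ler_wpM2l ?(ltW M0) //; apply: le_trans iq _.
    by rewrite ler_wpM2l // ler_nat.
  apply: le_trans t2 _.
  by rewrite ler_pM ?ler_nat ?invr_ge0 ?exprn_ge0.
rewrite [ltLHS]mulrA ltr_pdivrMr //.
have h4 : q.+1%:R * q%:R * q%:R * q%:R <= 256 * 2%:R ^+ q :> R.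
  rewrite -natrX -!natrM ler_nat; apply: leq_trans (quartic_le_exp2 q).
  rewrite (expnS _ 3) (expnS _ 2) -mulnn !mulnA.
  by rewrite !leq_mul.
have X3 : 256 * M / e < q%:R by rewrite (lt_le_trans X2) // ler_nat.
rewrite ltr_pdivrMr // in X3.
(* The extra factor [q] makes the left side quartic, hence at most [256 M 2 ^ q]; on the right it
   supplies the [q] that exceeds [256 M / e]. *)
rewrite -(ltr_pM2r q0).
apply: (@le_lt_trans _ _ (M * (256 * 2 ^+ q))).
  apply: le_trans (ler_wpM2l (ltW M0) h4); rewrite le_eqVlt; apply/orP; left.
  by apply/eqP; move: q.+1%:R q%:R => x y; ring.
have -> : M * (256 * 2 ^+ q) = 256 * M * 2 ^+ q by ring.
by rewrite [ltRHS]mulrAC ltr_pM2r // [ltRHS]mulrC.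
Qed.

(** * Primitive roots of unity in [C_p] *)

(** A root [z] of [1 + X + ... + X^(p-1)] has [z ^+ p = 1], and [z != 1] because [p] is nonzero in
    [F]. A [p ^ k]-th root [w] of [z] has order dividing [p ^ k.+1] but not [p ^ k]. *)
Lemma closed_field_prim_root (F : fieldType) p k : GRing.closed_field_axiom F ->
  prime p -> p%:R != 0 :> F -> exists w : F, (p ^ k).-primitive_root w.
Proof.
move=> clF pp p0; case: k => [|k].
  have [//|m prw] := @prim_order_exists F 1 1 _ (expr1n _ 1).
  by rewrite dvdn1 => /eqP m1; exists 1; rewrite expn0 -m1.
have p1 : (0 < p.-1)%N by rewrite -ltnS prednK ?prime_gt1 ?prime_gt0.
have [z zp z1] : exists2 z : F, z ^+ p = 1 & z != 1.
  (* The axiom solves [z ^+ n = \sum_(i < n) P i * z ^+ i]; taking every [P i] to be -1 gives the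
     cyclotomic equation. *)
  have [z zE] := clF p.-1 (fun=> -1) p1.
  have sz : \sum_(i < p) z ^+ i = 0.
    rewrite -(prednK (prime_gt0 pp)) big_ord_recr /= zE -big_split /= big1 // => i _.
    by rewrite mulN1r subrr.
  exists z; first by apply/eqP; rewrite -subr_eq0 subrX1 sz mulr0.
  apply: contra p0 => /eqP z1; rewrite -sz z1.
  by under eq_bigr do rewrite expr1n; rewrite sumr_const card_ord.
have pk0 : (0 < p ^ k)%N by rewrite expn_gt0 prime_gt0.
have [w wE] := clF (p ^ k)%N (fun i => if i == 0%N then z else 0) pk0.
have {}wE : w ^+ (p ^ k) = z.
  rewrite {}wE; case: (p ^ k)%N pk0 => // n _; rewrite big_ord_recl /= mulr1.
  by rewrite big1 ?addr0 // => i _; rewrite mul0r.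
have w1 : w ^+ (p ^ k.+1) = 1 by rewrite expnSr exprM wE.
have [|m prw] := prim_order_exists _ w1; first by rewrite expn_gt0 prime_gt0.
move=> /(dvdn_pfactor _ _ pp)[j jk mE]; exists w; move: jk; rewrite leq_eqVlt.
case/orP => [/eqP <-|jk]; first by rewrite -mE.
move: z1; rewrite -wE -(prim_order_dvd prw) mE dvdn_exp2l //.
Qed.

Lemma padic_abs_prime (R : realType) p : prime p -> padic_abs R p p%:R = p%:R^-1.
Proof.
move=> pp; rewrite /padic_abs pnatr_eq0 eqn0Ngt prime_gt0 //=.
have -> : p%:R = (p%:Z)%:~R :> rat by [].
rewrite numq_int denq_int /= logn1 logn_prime // eqxx.
by rewrite expr0 expr1 mul1r.
Qed.

(** The roots of unity are found in the algebraically closed [Qpbar] and carried to [K] by [k]; the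
    value of [|p|] is carried from the rationals. *)
Lemma is_Cp_complete_with_roots (R : realType) p (K : fieldType) (v : K -> R) :
  prime p -> is_Cp p v ->
  [/\ nonarch_abs v, abs_complete v, v p%:R = p%:R^-1 &
      forall k, exists w : K, (p ^ k).-primitive_root w].
Proof.
move=> pp [Qp [vQp [i [Qpbar [vQpbar [j [k]]]]]]].
case=> [[_ iv _ _] [clos _] vbP jv [vP kv cv _]].
have vp : v p%:R = p%:R^-1.
  have -> : p%:R = k (j (i p%:R)) by rewrite !rmorph_nat.
  by rewrite kv jv iv padic_abs_prime.
split=> // n; have p0 : p%:R != 0 :> Qpbar.
  apply: contra_eq_neq vp => p0.
  have -> : p%:R = k p%:R by rewrite rmorph_nat.
  by rewrite p0 rmorph0 (abs0 vP) eq_sym invr_eq0 pnatr_eq0 -lt0n prime_gt0.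
have [w prw] := closed_field_prim_root n clos pp p0.
by exists (k w); rewrite fmorph_primitive_root.
Qed.

(** * Path means and integrals along an arc *)

Section ArcIntegral.
Variables (R : realType) (p : nat) (K : fieldType) (v : K -> R).
Variables (vP : nonarch_abs v) (cv : abs_complete v).
Variables (pp : prime p) (vp : v p%:R = p%:R^-1).
Variable (roots : forall k, exists w : K, (p ^ k).-primitive_root w).
Variables (a b : K).
Implicit Types (f g h : K -> K) (phi : path_sequence) (Phi : set path_sequence).

(** The powers of [w] with exponents below [p ^ phi k] enumerate the roots of unity without
    repetition, which turns the sum over a set into an indexed one. *)
Lemma path_meanE f phi k (w : K) : (p ^ phi k).-primitive_root w ->
  path_mean p a b f phi k = (p%:R ^+ phi k)^-1 *
    \sum_(i < p ^ phi k) (b - a) * w ^+ i * f (a + (b - a) * w ^+ i).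
Proof.
move=> prw; rewrite /path_mean; congr (_ * _); set N := (p ^ phi k)%N in prw *.
have -> : [set z : K | z ^+ N = 1] = (fun i => w ^+ i) @` `I_N.
  apply/seteqP; split=> z /=.
    by move=> /(prim_rootP prw)[i ->]; exists i => /=.
  by move=> [i _ <-]; rewrite -exprM mulnC exprM (prim_expr_order prw) expr1n.
rewrite fsbig_image.
  rewrite -fsbig_ord; apply: eq_bigr => i _ /=.
  by rewrite [a + _ - a]addrC addKr.
move=> i j; rewrite !inE /= => iN jN /eqP.
by rewrite (eq_prim_root_expr prw) !modn_small // => /eqP.
Qed.

Lemma arc_disc_unity_root k z : a != b -> z ^+ (p ^ k) = 1 ->
  arc_disc v a b (a + (b - a) * z).
Proof.
move=> ab zN; rewrite /arc_disc /=.
have -> : a + (b - a) * z - b = (b - a) * (z - 1) by ring.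
rewrite (absM vP) (absB vP) gtr_pMr ?(abs_unity_root_sub1_lt1 vP pp vp zN) //.
by rewrite (abs_gt0 vP) subr_eq0.
Qed.

(** An identity on the arc is enough, since all the evaluation points lie in it; the product rule is
    available only there. *)
Lemma path_meanD f g h phi k : a != b ->
  (forall x, arc_disc v a b x -> h x = f x + g x) ->
  path_mean p a b h phi k = path_mean p a b f phi k + path_mean p a b g phi k.
Proof.
move=> ab hfg; have [w prw] := roots (phi k).
rewrite !(path_meanE _ prw) -mulrDr -big_split /=; congr (_ * _).
apply: eq_bigr => i _; rewrite hfg ?mulrDr //.
apply: (@arc_disc_unity_root (phi k)) => //.
by rewrite -exprM mulnC exprM (prim_expr_order prw) expr1n.
Qed.

(** The finitely many terms below the threshold are added to the constant, which suffices because
    [(n + 1) ^ beta] is at least 1. Index 0, where the power may vanish, is left out. *)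
Lemma controlled_bound beta h : 0 <= beta -> controlled v a b beta h ->
  exists2 c, power_series_on v a b h c & exists2 M, 0 < M &
    forall n, v (c n.+1) * v (a - b) ^+ n.+1 <= M * n.+1%:R `^ beta.
Proof.
move=> b0 [c hc [M [n0 [n00 cM]]]]; exists c => //.
pose m := (Num.Def.trunc n0).+1; pose u n := v (c n) * v (a - b) ^+ n.
have u0 n : 0 <= u n by rewrite mulr_ge0 ?exprn_ge0 ?(abs_ge0 vP).
have S0 : 0 <= \sum_(i < m) u i by apply: sumr_ge0.
exists (1 + `|M| + \sum_(i < m) u i).
  by rewrite ltr_pwDl // ltr_pwDl.
move=> n; rewrite -/(u n.+1).
have n1 : 1 <= n.+1%:R `^ beta.
  by rewrite -[leLHS](powRr0 n.+1%:R) ler_powR // ler1n.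
have [mn|nm] := leqP m n.+1.
  have /cM/ltW h1 : n0 < n.+1%:R.
    by apply: lt_le_trans (truncnS_gt n0) _; rewrite ler_nat.
  apply: le_trans h1 _; rewrite ler_wpM2r ?powR_ge0 //.
  have := ler_norm M; lra.
rewrite (bigD1 (Ordinal nm)) //=; set T := \sum_(i < m | _) _.
have T0 : 0 <= T by apply: sumr_ge0.
have := normr_ge0 M; have := u0 n.+1; move: (u n.+1) => U U0 M0.
by rewrite -[leLHS]mulr1 ler_pM //; lra.
Qed.

(** The threshold concerns the value [phi k] only, so one [k0] serves all path sequences. *)
Lemma path_mean_deriv_cvg0 beta h : a != b ->
  0 <= beta -> beta < 1 / 2 -> controlled v a b beta h ->
  forall e : R, 0 < e -> exists k0, forall phi k, (k0 <= phi k)%N ->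
    v (path_mean p a b (abs_deriv v h) phi k) < e.
Proof.
move=> ab b0 b12 /(controlled_bound b0)[c hc [M M0 cM]] e e0.
(* Passing to the limit over partial sums keeps only a non-strict bound, hence the margin. *)
have e2 : 0 < e / 2 by lra.
have [k0 hk0] := powR_mul_small (prime_gt1 pp) b0 b12 M0 e2.
exists k0 => phi k k0k; have [w prw] := roots (phi k).
rewrite (path_meanE _ prw); set q := phi k in k0k prw *.
pose N := (p ^ q)%N.
have N0 : (0 < N)%N by rewrite expn_gt0 prime_gt0.
have pi0 : p%:R != 0 :> K.
  by rewrite -(abs_gt0 vP) vp invr_gt0 ltr0n prime_gt0.
have pi1 : v p%:R < 1.
  by rewrite vp invf_lt1 ?ltr0n ?ltr1n ?prime_gt0 ?prime_gt1.
have hd := power_series_deriv vP cv pi0 pi1 hc.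
have lim : abs_cvg v (fun n => (p%:R ^+ q)^-1 * \sum_(j < N) (b - a) * w ^+ j *
     \sum_(i < n) deriv_coef c i * (a + (b - a) * w ^+ j - b) ^+ i)
   ((p%:R ^+ q)^-1 * \sum_(j < N) (b - a) * w ^+ j *
     abs_deriv v h (a + (b - a) * w ^+ j)).
  apply: (abs_cvgMl vP); apply: (abs_cvg_sum vP) => j; apply: (abs_cvgMl vP).
  apply: hd; apply: (@arc_disc_unity_root q) => //.
  by rewrite -exprM mulnC exprM (prim_expr_order prw) expr1n.
apply: (@le_lt_trans _ _ (e / 2)); last by lra.
apply: (abs_cvg_le vP lim) => n.
(* At [x = a + (b - a) zeta] one has [x - b = (b - a) (zeta - 1)]. Exchanging the two sums collects,
   for each [i], a power of [b - a] and a moment. *)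
have -> : (p%:R ^+ q)^-1 * \sum_(j < N) (b - a) * w ^+ j *
     \sum_(i < n) deriv_coef c i * (a + (b - a) * w ^+ j - b) ^+ i =
   \sum_(i < n) c i.+1 * (b - a) ^+ i.+1 * (N%:R^-1 * unity_root_moment p q w i).
  rewrite -natrX; under eq_bigr do rewrite mulr_sumr.
  rewrite exchange_big mulr_sumr; apply: eq_bigr => i _ /=.
  rewrite mulrCA; congr (_ * _); rewrite mulr_sumr; apply: eq_bigr => j _.
  have -> : a + (b - a) * w ^+ j - b = (b - a) * (w ^+ j - 1) by ring.
  rewrite exprMn exprS /deriv_coef.
  by move: (b - a) (_ ^+ i) ((w ^+ j - 1) ^+ i) (w ^+ j) => x y z t; ring.
apply: (abs_sum_le vP) => [|i _]; first exact: ltW.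
rewrite !(absM vP) (absX vP) (absB vP b) (absV vP) (abs_natX vP vp) invrK.
have NR : 0 < N%:R :> R by rewrite ltr0n.
(* Since [|1 / N| = N], [t] is [N] times the size of the moment; the two moment bounds become
   [1 / N] and [N p^-(i %/ N)]. *)
set t := _ * v (unity_root_moment _ _ _ _).
have t0 : 0 <= t by rewrite mulr_ge0 ?(abs_ge0 vP).
apply: le_trans (ler_wpM2r t0 (cM i)) _; apply/ltW/(hk0 q) => //.
  by rewrite -ler_pdivlMl // abs_unity_root_moment_le.
by rewrite ler_wpM2l // abs_unity_root_moment_exp.
Qed.

Lemma is_arc_integral_unique Phi f L1 L2 : interlocked Phi ->
  is_arc_integral p v a b Phi f L1 -> is_arc_integral p v a b Phi f L2 -> L1 = L2.
Proof.
move=> [_ il] h1 h2; apply/eqP; rewrite -subr_eq0; apply/eqP/(abs_lt_eq0 vP) => e e0.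
have [phi1 P1 [N1 k1]] := h1 _ e0; have [phi2 P2 [N2 k2]] := h2 _ e0.
have [phi3 _ [k0 [_ [s1 [m1 t1]] [s2 [m2 t2]]]]] := il _ _ P1 P2.
(* Strict growth makes [s1 k] and [s2 k] exceed [N1] and [N2] once [k] is far enough beyond [k0]. *)
have grow s : (forall k l, (k0 <= k)%N -> (k < l)%N -> (s k < s l)%N) ->
    forall n, (n <= s (k0 + n))%N.
  move=> ms; elim=> // n IH; apply: leq_ltn_trans IH _.
  by rewrite ms ?leq_addr // addnS.
pose k := (k0 + (N1 + N2).+1)%N.
have kk : (k0 <= k)%N by exact: leq_addr.
have [st1 e1] := t1 k kk; have [st2 e2] := t2 k kk.
have l1 : (N1 < s1 k)%N by apply: leq_trans (grow _ m1 _); rewrite ltnS leq_addr.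
have l2 : (N2 < s2 k)%N by apply: leq_trans (grow _ m2 _); rewrite ltnS leq_addl.
have := k1 _ st1 l1; have := k2 _ st2 l2.
(* A mean depends on the path sequence only through its value at the index, so both means are the
   same [A], close to [L1] and to [L2]. *)
rewrite /path_mean -e1 -e2; set A := _^-1 * _ => {}k2 {}k1.
have -> : L1 - L2 = (A - L2) - (A - L1) by ring.
by apply: (abs_add_lt vP); rewrite ?(absN vP).
Qed.

Lemma arc_integralE Phi f L : interlocked Phi -> is_arc_integral p v a b Phi f L ->
  arc_integral p v a b Phi f = L.
Proof.
by move=> il h; apply: xget_unique => // L' /(is_arc_integral_unique il)/(_ h).
Qed.

Lemma path_sequence_ge phi n :
  exists m, forall k, (path_start phi <= k)%N -> (m <= k)%N -> (n <= phi k)%N.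
Proof.
have grow i : (i <= phi (path_start phi + i))%N.
  elim: i => // i IH; apply: leq_ltn_trans IH _.
  by apply: path_incr; rewrite ?leq_addr // addnS.
exists (path_start phi + n)%N => k sk nk.
rewrite -(subnKC sk); apply: leq_trans (grow _).
by rewrite leq_subRL.
Qed.

(** As the hypothesis on the sum is uniform in [phi], the path sequence chosen for [g] also serves
    [f]. *)
Lemma is_arc_integralN Phi f g L :
  (forall e : R, 0 < e -> exists k0, forall phi k, (k0 <= phi k)%N ->
    v (path_mean p a b f phi k + path_mean p a b g phi k) < e) ->
  is_arc_integral p v a b Phi g L -> is_arc_integral p v a b Phi f (- L).
Proof.
move=> hfg hg e e0; have [k0 hk0] := hfg _ e0; have [phi Pphi [N hN]] := hg _ e0.
exists phi => //; have [m hm] := path_sequence_ge phi k0.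
exists (maxn N m) => k sk; rewrite gtn_max => /andP[Nk mk].
have := hN k sk Nk; have := hk0 phi k (hm k sk (ltnW mk)).
set A := path_mean _ _ _ f _ _; set B := path_mean _ _ _ g _ _ => h1 h2.
have -> : A - - L = (A + B) - (B - L) by ring.
by apply: (abs_add_lt vP); rewrite ?(absN vP).
Qed.

End ArcIntegral.

Unset Implicit Arguments.
Set Strict Implicit.

Theorem theorem4p4 (R : realType) (p : nat) (Cp : fieldType) (v : Cp -> R)
  (a b : Cp) (Phi : set path_sequence) (f g : Cp -> Cp) :
  prime p -> odd p -> is_Cp p v ->
  a <> b -> interlocked Phi ->
  arc_H v a b f -> arc_H v a b g ->
  (exists beta : R, [/\ 0 <= beta, beta < 1 / 2 &
     controlled v a b beta (fun x => f x * g x)]) ->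
  arc_integrable p v a b Phi (fun x => f x * abs_deriv v g x) ->
  arc_integrable p v a b Phi (fun x => abs_deriv v f x * g x) /\
  arc_integral p v a b Phi (fun x => abs_deriv v f x * g x)
    = - arc_integral p v a b Phi (fun x => f x * abs_deriv v g x).
Proof.
move=> pp _ /(is_Cp_complete_with_roots pp)[vP cv vp roots] /eqP ab il Hf Hg.
move=> [beta [b0 b12 fgc]] [_ [L hL]].
have pi0 : p%:R != 0 :> Cp.
  by rewrite -(abs_gt0 vP) vp invr_gt0 ltr0n prime_gt0.
have pi1 : v p%:R < 1.
  by rewrite vp invf_lt1 ?ltr0n ?ltr1n ?prime_gt0 ?prime_gt1.
have product_rule x : arc_disc v a b x ->
    abs_deriv v (fun y => f y * g y) x =
    abs_deriv v f x * g x + f x * abs_deriv v g x.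
  move=> xab; apply: (abs_derivE vP pi0 pi1).
  by apply: (is_abs_derivM vP); apply: (arc_H_is_abs_deriv vP cv pi0 pi1 _ xab).
(* By the product rule the two means add up to the mean of the derivative of [f g], which tends to
   0. *)
have hN : is_arc_integral p v a b Phi (fun x => abs_deriv v f x * g x) (- L).
  apply: (is_arc_integralN vP _ hL) => e e0.
  have [k0 hk0] := path_mean_deriv_cvg0 vP cv pp vp roots ab b0 b12 fgc e0.
  exists k0 => phi k /hk0.
  by rewrite (path_meanD vP pp vp roots phi k ab product_rule).
(* Uniqueness along an interlocked family identifies the chosen values with [- L] and [L]. *)
rewrite (arc_integralE vP il hN) (arc_integralE vP il hL); split=> //; split.
  by apply: (arc_H_mul vP) => //; apply: (arc_H_deriv vP cv pi0 pi1).
by exists (- L).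
Qed.
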